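(* Let $m,n,s,k$ be four integers such that $2\leq s\leq n$, $2\leq k\leq m$ and $ms=nk$. Let $\lambda$ be a (positive) divisor of $2nk$ and let $t$ be a (positive) divisor of $\frac{2nk}{\lambda}$. Set $d=\gcd(s,k)$. Then: (i) if there exists a diagonal ${}^\lambda\mathrm{H}_t\left(\frac{nk}{d};d\right)$, then there exists a ${}^\lambda\mathrm{H}_t(m,n;s,k)$; (ii) if there exists an integer diagonal ${}^\lambda\mathrm{H}_t\left(\frac{nk}{d};d\right)$, then there exists an integer ${}^\lambda\mathrm{H}_t(m,n;s,k)$; (iii) if there exists a shiftable diagonal ${}^\lambda\mathrm{H}_t\left(\frac{nk}{d};d\right)$, then there exists a shiftable ${}^\lambda\mathrm{H}_t(m,n;s,k)$.
   Context: A partially filled (pf) array is a matrix some of whose cells may be empty; row and column sums are taken over the filled cells. $\mathcal{E}(A)$ denotes the list (multiset) of entries of the filled cells of $A$. Let $m,n,s,k,t,\lambda$ be positive integers such that $\lambda$ divides $2nk$ and $t$ divides $\frac{2nk}{\lambda}$. Put $v=\frac{2nk}{\lambda}+t$ and let $J$ be the subgroup of order $t$ of $\mathbb{Z}_v$. A $\lambda$-fold Heffter array over $\mathbb{Z}_v$ relative to $J$, denoted ${}^\lambda\mathrm{H}_t(m,n;s,k)$, is an $m\times n$ pf array $A$ with entries in $\Omega=\mathbb{Z}_v\setminus J$ such that: (a) each row contains exactly $s$ filled cells and each column exactly $k$ filled cells; (b) every element of $\Omega$ appears exactly $\lambda$ times in the list $\mathcal{E}(A)\cup-\mathcal{E}(A)$;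 (c) the elements in every row and column sum to $0$ (in $\mathbb{Z}_v$). With $v=\frac{2nk}{\lambda}+t$ and $\ell=v/t$, let $\Phi=\{1,2,\ldots,\lfloor v/2\rfloor\}\setminus\{\ell,2\ell,\ldots,\lfloor t/2\rfloor\ell\}\subset\mathbb{Z}$. An integer ${}^\lambda\mathrm{H}_t(m,n;s,k)$ is an $m\times n$ pf array with integer entries whose absolute values lie in $\Phi$ such that: (a) each row contains exactly $s$ filled cells and each column exactly $k$ filled cells; (b) if $v$ is odd or $t$ is even, every element of $\Phi$ appears, up to sign, exactly $\lambda$ times in the array; if $v$ is even and $t$ is odd, every element of $\Phi\setminus\{v/2\}$ appears, up to sign, exactly $\lambda$ times while $v/2$ appears, up to sign, exactly $\lambda/2$ times; (c) the elements in every row and column sum to $0$ in $\mathbb{Z}$. ${}^\lambda\mathrm{H}_t(a;b)$ denotes ${}^\lambda\mathrm{H}_t(a,a;b,b)$. For a square pf array of size $a$ with rows and columns indexed by $\{1,\ldots,a\}$, the cell $(i,j)$ belongs to the diagonal $D_r$ if $j-i\equiv r\pmod a$. A (possibly integer) ${}^\lambda\mathrm{H}_t(a;b)$ is diagonal if its filled cells are exactly those of $b$ consecutive diagonals $D_r,D_{r+1},\ldots,D_{r+b-1}$ (indices modulo $a$). A pf array with entries in $\mathbb{Z}$ is shiftable if every row and every column contains an equal number of positive and negative entries; a shiftable ${}^\lambda\mathrm{H}_t$ means an integer ${}^\lambda\mathrm{H}_t$ that is shiftable. *)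

(* Defs.v *)
From HB Require Import structures.
From mathcomp Require Import all_boot all_order all_algebra all_fingroup.

Set Implicit Arguments.
Unset Strict Implicit.
Unset Printing Implicit Defensive.

Import GRing.Theory Num.Theory.

(* The empty cells of a partially filled array are those holding None. *)
Notation pfarray T m n := 'M[option T]_(m, n).

Definition filled (T : Type) m n (A : pfarray T m n) (i : 'I_m) (j : 'I_n) :
  bool := isSome (A i j).

Definition entries (T : Type) m n (A : pfarray T m n) : seq T :=
  pmap id [seq A i j | i <- enum 'I_m, j <- enum 'I_n].

Definition fill_counts (T : Type) m n (s k : nat) (A : pfarray T m n) : Prop :=
  (forall i : 'I_m, #|[pred j | filled A i j]| = s) /\
  (forall j : 'I_n, #|[pred i | filled A i j]| = k).

(* The default value in odflt is never used: only filled cells are summed. *)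
Definition row_sum (V : nmodType) m n (A : pfarray V m n) (i : 'I_m) : V :=
  (\sum_(j < n | filled A i j) odflt 0 (A i j))%R.

Definition col_sum (V : nmodType) m n (A : pfarray V m n) (j : 'I_n) : V :=
  (\sum_(i < m | filled A i j) odflt 0 (A i j))%R.

Definition zero_sums (V : nmodType) m n (A : pfarray V m n) : Prop :=
  (forall i, row_sum A i = 0%R) /\ (forall j, col_sum A j = 0%R).

Definition heffter_modulus (n k lam t : nat) : nat := (2 * n * k) %/ lam + t.

(* For n, k, lam, t > 0 the modulus is at least 2, so 'Z_v is really Z/vZ. *)
Notation heffter_ring n k lam t := 'Z_(heffter_modulus n k lam t).

Record is_heffter_rel m n (s k lam t : nat)
    (J : {group heffter_ring n k lam t})
    (A : pfarray (heffter_ring n k lam t) m n) : Prop := IsHeffterRel {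
  heffter_entries : forall x, x \in entries A -> x \notin J;
  heffter_fill : fill_counts s k A;
  heffter_count : forall x, x \notin J ->
    count_mem x (entries A ++ [seq (- y)%R | y <- entries A]) = lam;
  heffter_sums : zero_sums A
}.

(* Z_v is cyclic, so the subgroup J of order t is unique. *)
Definition is_heffter m n (s k lam t : nat)
    (A : pfarray (heffter_ring n k lam t) m n) : Prop :=
  exists2 J : {group heffter_ring n k lam t}, #|J| = t & is_heffter_rel s J A.
Arguments is_heffter {m n} s k lam t A.

Definition heffter_Phi (v t : nat) : seq nat :=
  [seq x <- iota 1 v./2 | x \notin [seq i * (v %/ t) | i <- iota 1 t./2]].

Definition count_abs m n (A : pfarray int m n) (x : nat) : nat :=
  count (fun z : int => absz z == x) (entries A).

Record is_int_heffter m n (s k lam t : nat) (A : pfarray int m n) : Prop :=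
  IsIntHeffter {
  int_heffter_entries : forall z, z \in entries A ->
    absz z \in heffter_Phi (heffter_modulus n k lam t) t;
  int_heffter_fill : fill_counts s k A;
  int_heffter_count :
    let v := heffter_modulus n k lam t in
    if odd v || ~~ odd t then
      forall x, x \in heffter_Phi v t -> count_abs A x = lam
    else
      (forall x, x \in heffter_Phi v t -> x != v %/ 2 -> count_abs A x = lam)
      /\ count_abs A (v %/ 2) = lam %/ 2;
  int_heffter_sums : zero_sums A
}.

Definition in_diagonal a (r : nat) (i j : 'I_a) : bool := j == i + r %[mod a].

Definition is_diagonal (T : Type) a (b : nat) (A : pfarray T a a) : Prop :=
  exists r : nat, forall i j : 'I_a,
    filled A i j <-> exists2 u : nat, u < b & in_diagonal (r + u) i j.

Definition is_pos_cell (x : option int) : bool :=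
  if x is Some z then (0 < z)%R else false.

Definition is_neg_cell (x : option int) : bool :=
  if x is Some z then (z < 0)%R else false.

Definition shiftable m n (A : pfarray int m n) : Prop :=
  (forall i : 'I_m,
     #|[pred j | is_pos_cell (A i j)]| = #|[pred j | is_neg_cell (A i j)]|) /\
  (forall j : 'I_n,
     #|[pred i | is_pos_cell (A i j)]| = #|[pred i | is_neg_cell (A i j)]|).

(* Main.v *)
Require Import Defs.
From HB Require Import structures.
From mathcomp Require Import all_boot all_order all_algebra all_fingroup.
From mathcomp Require Import zify.

(** Here [a = n k / d = lcm(m, n)] and [d <= gcd(m, n)].  Send the cell [(i, j)]
    of the square array to [(i mod m, j mod n)].  This is injective on [d]
    consecutive diagonals: the images of [(i, i + r + u)] and
    [(i', i' + r + u')] coincide only if [u = u'] modulo [gcd(m, n)], hence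
    [u = u'], and then [i = i'] modulo both [m] and [n], hence modulo [a].  Rows
    (columns) of the resulting [m x n] array are disjoint unions of rows
    (columns) of the square one, so all the required properties carry over. *)

Set Implicit Arguments.
Unset Strict Implicit.
Unset Printing Implicit Defensive.

Import GRing.Theory.

(** * Residues: fibre sizes and congruences *)

Lemma card_modn_eq m c (i : 'I_m) :
  #|[pred x : 'I_(c * m) | x %% m == i]| = c.
Proof.
rewrite -sum1_card big_mkcond /=.
rewrite -(big_mkord xpredT (fun x => if x %% m == i then 1 else 0)).
elim: c => [|c IHc]; first by rewrite mul0n big_geq.
(* Split off the last block of [m] consecutive integers, which meets the residue class exactly
   once. *)
rewrite (@big_cat_nat _ _ _ (c * m)) ?leq_mul2r ?leqnSn ?orbT //= IHc.
have modE (x : 'I_m) : (x + c * m) %% m = x by rewrite addnC modnMDl modn_small.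
rewrite mulSn addnC -{1}[c * m]add0n big_addn addnK big_mkord (bigD1 i) //=.
rewrite modE eqxx big1 ?addn0 ?addn1 // => x neq_xi.
by rewrite modE ifN.
Qed.

Lemma eq_modn_lcm m n x y :
  x = y %[mod m] -> x = y %[mod n] -> x = y %[mod lcmn m n].
Proof.
wlog le_yx : x y / y <= x.
  move=> W; case: (leqP y x) => [/W //|/ltnW/W {}W /esym xm /esym xn].
  exact/esym/W.
move=> /eqP xm /eqP xn; apply/eqP; move: xm xn.
by rewrite !eqn_mod_dvd // dvdn_lcm => -> ->.
Qed.

Lemma eq_modn_dvd d m x y : d %| m -> x = y %[mod m] -> x = y %[mod d].
Proof. by move=> dvd_dm eqxy; rewrite -(modn_dvdm x dvd_dm) eqxy modn_dvdm. Qed.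

Lemma eq_modn_ord a (i j : 'I_a) : i = j %[mod a] -> i = j.
Proof. by rewrite !modn_small // => /val_inj. Qed.

(** * Counts and line sums as sums over all cells *)

Lemma count_entries (T : Type) m n (A : pfarray T m n) (P : pred T) :
  count P (entries A) = \sum_(c : 'I_m * 'I_n) oapp P false (A c.1 c.2).
Proof.
rewrite /entries (_ : count P (pmap id _) =
    count (oapp P false) [seq A i j | i <- enum 'I_m, j <- enum 'I_n]); last first.
  by elim: [seq A i j | i <- _, j <- _] => //= -[x|] l /= ->.
rewrite -sumn_count sumnE big_map big_allpairs_dep /=.
rewrite -(pair_bigA _ (fun i j => oapp P false (A i j) : nat)) /= !big_enum /=.
by under eq_bigr do rewrite big_enum /=.
Qed.

Lemma row_sumE (V : nmodType) m n (A : pfarray V m n) i :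
  row_sum A i = (\sum_j odflt 0 (A i j))%R.
Proof.
by rewrite /row_sum big_mkcond; apply: eq_bigr => j _; rewrite /filled; case: (A i j).
Qed.

Lemma col_sumE (V : nmodType) m n (A : pfarray V m n) j :
  col_sum A j = (\sum_i odflt 0 (A i j))%R.
Proof.
by rewrite /col_sum big_mkcond; apply: eq_bigr => i _; rewrite /filled; case: (A i j).
Qed.

Lemma card_pred_sum (I : finType) (P : pred I) : #|[pred i | P i]| = \sum_i P i.
Proof.
by rewrite -sum1_card big_mkcond; apply: eq_bigr => i _; rewrite inE; case: (P i).
Qed.

(** * Folding an array along a row map and a column map *)

Section Fold.

Variables (T : Type) (a b m n : nat) (p : 'I_a -> 'I_m) (q : 'I_b -> 'I_n).
Variable B : pfarray T a b.

(** [pick] makes the array total; under [fold_inj] a cell has at most one filled preimage, so the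
    choice is immaterial. *)
Definition fold_array : pfarray T m n :=
  \matrix_(i, j)
    if [pick c : 'I_a * 'I_b | [&& filled B c.1 c.2, p c.1 == i & q c.2 == j]]
    is Some c then B c.1 c.2 else None.

(** Only filled cells are compared: on all cells the map cannot be injective once
    [a * b > m * n]. *)
Definition fold_inj : Prop := forall i j i' j', filled B i j -> filled B i' j' ->
  p i = p i' -> q j = q j' -> i = i' /\ j = j'.

Hypothesis injB : fold_inj.

Section Sums.

Variables (V : nmodType) (F : option T -> V).
Hypothesis F0 : F None = 0%R.

(** Each fibre holds at most one filled cell, and [F] vanishes on empty ones. Different choices of
    [F] and of the region [R] yield entry counts, fill counts, line sums and sign counts. *)
Lemma fold_array_sum (R : 'I_m -> 'I_n -> bool) :
  (\sum_(c | R c.1 c.2) F (fold_array c.1 c.2) =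
   \sum_(c | R (p c.1) (q c.2)) F (B c.1 c.2))%R.
Proof.
have FN (c : 'I_a * 'I_b) : ~~ filled B c.1 c.2 -> F (B c.1 c.2) = 0%R.
  by rewrite /filled; case: (B _ _).
rewrite [RHS](bigID (fun c => filled B c.1 c.2)) /=.
rewrite [X in (_ + X)%R]big1 ?addr0; last by move=> c /andP[_ /FN].
(* Group the filled cells by their image. *)
rewrite (partition_big (fun c => (p c.1, q c.2)) (fun c => R c.1 c.2)) /=; last first.
  by move=> c /andP[].
apply: eq_bigr => -[i j] /= Rij; rewrite mxE.
case: pickP => [[i0 j0] /= /and3P[f0 /eqP pi0 /eqP qj0]|none].
  rewrite (big_pred1 (i0, j0)) // => -[i1 j1] /=.
  apply/idP/eqP => [/andP[/andP[_ f1] /eqP[pi1 qj1]]|[-> ->]].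
    by have [|| -> ->] := injB f1 f0; rewrite ?pi1 ?qj1.
  by rewrite pi0 qj0 Rij f0 eqxx.
rewrite big_pred0 => [|[i1 j1] /=]; first by rewrite F0.
by apply/negP => /andP[/andP[_ f1] /eqP[pi1 qj1]];
  have := none (i1, j1); rewrite /= f1 pi1 qj1 !eqxx.
Qed.

Lemma fold_array_row i :
  (\sum_j F (fold_array i j) = \sum_(i' | p i' == i) \sum_j F (B i' j))%R.
Proof.
rewrite (pair_big (fun i' => p i' == i) xpredT (fun i' j => F (B i' j))) /=.
under [RHS]eq_bigl do rewrite andbT.
rewrite -(fold_array_sum (fun i' _ => i' == i)) /=.
under [RHS]eq_bigl => c do rewrite -[_ == i]andbT.
rewrite -(pair_big (fun i' => i' == i) xpredT (fun i' j => F (fold_array i' j))) /=.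
by rewrite big_pred1_eq.
Qed.

Lemma fold_array_col j :
  (\sum_i F (fold_array i j) = \sum_(j' | q j' == j) \sum_i F (B i j'))%R.
Proof.
rewrite [RHS]exchange_big /=.
rewrite (pair_big xpredT (fun j' => q j' == j) (fun i' j' => F (B i' j'))) /=.
rewrite -(fold_array_sum (fun _ j' => j' == j)) /=.
rewrite -(pair_big xpredT (fun j' => j' == j) (fun i' j' => F (fold_array i' j'))) /=.
by under [RHS]eq_bigr do rewrite big_pred1_eq.
Qed.

End Sums.

(** With [P] arbitrary, this says that folding preserves the multiset of entries. *)
Lemma count_entries_fold (P : pred T) :
  count P (entries fold_array) = count P (entries B).
Proof.
by rewrite !count_entries
  (@fold_array_sum nat (fun x => oapp P false x : nat) _ (fun _ _ => true)).
Qed.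

Lemma fold_array_fill s k s' k' :
    (forall i, #|[pred x | p x == i]| = s') ->
    (forall j, #|[pred x | q x == j]| = k') ->
  fill_counts s k B -> fill_counts (s' * s) (k' * k) fold_array.
Proof.
move=> cp cq [fr fc]; split=> [i|j]; rewrite card_pred_sum.
  rewrite (@fold_array_row nat (fun x => isSome x : nat)) //.
  under eq_bigr do rewrite -(card_pred_sum (filled B _)) fr.
  by rewrite sum_nat_const cp.
rewrite (@fold_array_col nat (fun x => isSome x : nat)) //.
under eq_bigr do rewrite -(card_pred_sum (filled B ^~ _)) fc.
by rewrite sum_nat_const cq.
Qed.

End Fold.

Lemma mem_entries_fold (T : eqType) a b m n (p : 'I_a -> 'I_m) (q : 'I_b -> 'I_n)
    (B : pfarray T a b) : fold_inj p q B -> entries (fold_array p q B) =i entries B.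
Proof. by move=> injB x; rewrite -!has_pred1 !has_count count_entries_fold. Qed.

Lemma fold_array_zero_sums (V : nmodType) a b m n
    (p : 'I_a -> 'I_m) (q : 'I_b -> 'I_n) (B : pfarray V a b) :
  fold_inj p q B -> zero_sums B -> zero_sums (fold_array p q B).
Proof.
move=> injB [r0 c0]; split=> [i|j].
  rewrite row_sumE (fold_array_row injB) // big1 // => x _.
  by rewrite -row_sumE.
rewrite col_sumE (fold_array_col injB) // big1 // => x _.
by rewrite -col_sumE.
Qed.

Lemma fold_array_shiftable a b m n (p : 'I_a -> 'I_m) (q : 'I_b -> 'I_n)
    (B : pfarray int a b) :
  fold_inj p q B -> shiftable B -> shiftable (fold_array p q B).
Proof.
move=> injB [shr shc]; split=> [i|j]; rewrite !card_pred_sum.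
  rewrite (fold_array_row injB (V := nat) (F := fun x => is_pos_cell x : nat)) //.
  rewrite (fold_array_row injB (V := nat) (F := fun x => is_neg_cell x : nat)) //.
  by apply: eq_bigr => x _; have := shr x; rewrite !card_pred_sum.
rewrite (fold_array_col injB (V := nat) (F := fun x => is_pos_cell x : nat)) //.
rewrite (fold_array_col injB (V := nat) (F := fun x => is_neg_cell x : nat)) //.
by apply: eq_bigr => x _; have := shc x; rewrite !card_pred_sum.
Qed.

(** * Reduction modulo [m] and [n] on consecutive diagonals *)

Definition ord_mod a m (m_gt0 : 0 < m) (i : 'I_a) : 'I_m :=
  Ordinal (ltn_pmod i m_gt0).

Lemma diagonal_fold_inj (T : Type) m n d (m_gt0 : 0 < m) (n_gt0 : 0 < n)
    (B : pfarray T (lcmn m n) (lcmn m n)) :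
  d <= gcdn m n -> is_diagonal d B -> fold_inj (ord_mod m_gt0) (ord_mod n_gt0) B.
Proof.
move=> led [r diagB] i j i' j' /diagB[u ltu /eqP Dj] /diagB[u' ltu' /eqP Dj'].
move=> [eqm] [eqn].
have eqn_ru : i + (r + u) = i' + (r + u') %[mod n].
  by rewrite -(eq_modn_dvd (dvdn_lcmr m n) Dj) -(eq_modn_dvd (dvdn_lcmr m n) Dj').
have equ : u = u'.
  (* Modulo the gcd, [i] and [i'] agree as well, so [i + r] cancels; both [u] and [u'] are below
     [d], hence below the gcd. *)
  have := eq_modn_dvd (dvdn_gcdr m n) eqn_ru.
  rewrite -modnDml (eq_modn_dvd (dvdn_gcdl m n) eqm) modnDml !addnA => /eqP.
  by rewrite eqn_modDl !modn_small ?(leq_trans _ led) // => /eqP.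
have eqi : i = i'.
  apply/eq_modn_ord/eq_modn_lcm => //.
  by move: eqn_ru => /eqP; rewrite equ eqn_modDr => /eqP.
by split=> //; apply: eq_modn_ord; rewrite Dj Dj' eqi equ.
Qed.

(* [is_heffter_rel] with the modulus [v] as a free parameter, so that it can be
   rewritten along equations between moduli. *)
Definition heffter_over v m n (s k lam t : nat) (A : pfarray 'Z_v m n) : Prop :=
  exists J : {group 'Z_v},
    [/\ #|J| = t, forall x, x \in entries A -> x \notin J, fill_counts s k A,
        forall x, x \notin J ->
          count_mem x (entries A ++ [seq (- y)%R | y <- entries A]) = lam
      & zero_sums A].

Lemma is_heffterE m n s k lam t (A : pfarray (heffter_ring n k lam t) m n) :
  is_heffter s k lam t A <-> heffter_over s k lam t A.
Proof.
by split=> [[J oJ [? ? ? ?]]|[J [oJ ? ? ? ?]]]; exists J.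
Qed.

(** * Heffter conditions under folding *)

Section FoldHeffter.

Variables (a m n d s' k' : nat) (p : 'I_a -> 'I_m) (q : 'I_a -> 'I_n).
Hypotheses (cp : forall i, #|[pred x | p x == i]| = s')
           (cq : forall j, #|[pred x | q x == j]| = k').

Lemma fold_heffter_over v lam t (B : pfarray 'Z_v a a) : fold_inj p q B ->
  heffter_over d d lam t B ->
  heffter_over (s' * d) (k' * d) lam t (fold_array p q B).
Proof.
move=> injB [J [oJ eB fB cB zB]]; exists J; split=> //.
- by move=> x; rewrite mem_entries_fold //; apply: eB.
- exact: fold_array_fill.
- move=> x /cB; rewrite !count_cat !count_map => <-.
  by rewrite !count_entries_fold.
- exact: fold_array_zero_sums.
Qed.

(** The entries are integers, so the modulus enters only through [heffter_Phi] and the prescribed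
    counts; equality of moduli suffices. *)
Lemma fold_int_heffter lam t (B : pfarray int a a) : fold_inj p q B ->
  heffter_modulus a d lam t = heffter_modulus n (k' * d) lam t ->
  is_int_heffter d d lam t B ->
  is_int_heffter (s' * d) (k' * d) lam t (fold_array p q B).
Proof.
move=> injB eqv [eB fB cB zB]; rewrite eqv in eB cB.
have eq_abs x : count_abs (fold_array p q B) x = count_abs B x.
  exact: count_entries_fold.
split.
- by move=> x; rewrite mem_entries_fold //; apply: eB.
- exact: fold_array_fill.
- move: cB => /=; case: ifP => _ => [cB x /cB|[cB cB2]]; first by rewrite eq_abs.
  by split=> [x xPhi xv|]; rewrite eq_abs ?cB2 // cB.
- exact: fold_array_zero_sums.
Qed.

End FoldHeffter.

Theorem theorem3p3 (m n s k lam t : nat)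
    (hs2 : 2 <= s) (hsn : s <= n) (hk2 : 2 <= k) (hkm : k <= m)
    (hmsnk : m * s = n * k)
    (hlam0 : 0 < lam) (hlam : lam %| 2 * n * k)
    (ht0 : 0 < t) (ht : t %| (2 * n * k) %/ lam) :
  let d := gcdn s k in
  let a := (n * k) %/ d in
  [/\ (exists B : pfarray (heffter_ring a d lam t) a a,
         is_heffter d d lam t B /\ is_diagonal d B) ->
      exists A : pfarray (heffter_ring n k lam t) m n, is_heffter s k lam t A,
      (exists B : pfarray int a a,
         is_int_heffter d d lam t B /\ is_diagonal d B) ->
      exists A : pfarray int m n, is_int_heffter s k lam t A
    & (exists B : pfarray int a a,
         [/\ is_int_heffter d d lam t B, shiftable B & is_diagonal d B]) ->
      exists A : pfarray int m n, is_int_heffter s k lam t A /\ shiftable A].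
Proof.
move=> d a.
have d_gt0 : 0 < d by rewrite gcdn_gt0 (leq_trans _ hs2).
have [n_gt0 m_gt0] : 0 < n /\ 0 < m by lia.
have [s' Ds] := dvdnP (dvdn_gcdl s k); have [k' Dk] := dvdnP (dvdn_gcdr s k).
rewrite -/d in Ds Dk.
have s'_gt0 : 0 < s' by move: hs2; rewrite Ds; case: (s').
have ms'nk' : m * s' = n * k'.
  by apply/eqP; rewrite -(eqn_pmul2r d_gt0) -!mulnA -Ds -Dk hmsnk.
have co_s'k' : gcdn s' k' = 1.
  by apply/eqP; rewrite -(eqn_pmul2r d_gt0) mul1n muln_gcdl -Ds -Dk.
(* [s' * gcdn m n = gcdn (s' * m) (s' * n) = gcdn (n * k') (n * s') = n], as [s'] and [k'] are
   coprime. *)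
have De : s' * gcdn m n = n.
  rewrite muln_gcdr [s' * m]mulnC ms'nk' [s' * n]mulnC -muln_gcdr gcdnC.
  by rewrite co_s'k' muln1.
(* After multiplication by [s'] this is [s <= n]. *)
have led : d <= gcdn m n by rewrite -(leq_pmul2l s'_gt0) De -Ds.
have e_gt0 : 0 < gcdn m n by rewrite gcdn_gt0 m_gt0.
have Dl : lcmn m n = s' * m.
  by apply/eqP; rewrite -(eqn_pmul2r e_gt0) muln_lcm_gcd mulnAC De mulnC.
have Dl' : lcmn m n = k' * n by rewrite Dl mulnC ms'nk' mulnC.
have Da : a = lcmn m n by rewrite /a Dk mulnA mulnK // Dl' mulnC.
(* Both moduli agree because [a * d = n * k]. *)
have eqv : heffter_modulus a d lam t = heffter_modulus n k lam t.
  rewrite /heffter_modulus Da Dl' Dk -mulnA -[2 * n * _]mulnA.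
  by congr ((2 * _) %/ _ + _); lia.
(* Replace [a] by [lcmn m n] inside the array types, where [diagonal_fold_inj] applies. *)
clearbody a; subst a.
pose p : 'I_(lcmn m n) -> 'I_m := ord_mod m_gt0.
pose q : 'I_(lcmn m n) -> 'I_n := ord_mod n_gt0.
have cp i : #|[pred x | p x == i]| = s' by rewrite /p Dl; apply: card_modn_eq.
have cq j : #|[pred x | q x == j]| = k' by rewrite /q Dl'; apply: card_modn_eq.
split.
- case=> B [/is_heffterE hB dB].
  (* The type of [A] depends on the modulus; with [A] bound in the goal, [eqv] can be rewritten
     there too. *)
  suff [A hA] : exists A : pfarray (heffter_ring n k lam t) m n,
    heffter_over s k lam t A by exists A; apply/is_heffterE.
  rewrite -eqv Ds Dk; exists (fold_array p q B); apply: fold_heffter_over => //.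
  exact: diagonal_fold_inj dB.
- case=> B [hB dB]; exists (fold_array p q B).
  rewrite Ds Dk; apply: fold_int_heffter; rewrite -?Dk //.
  exact: diagonal_fold_inj dB.
- case=> B [hB shB dB]; exists (fold_array p q B).
  have injB : fold_inj p q B by apply: diagonal_fold_inj dB.
  split; last exact: fold_array_shiftable.
  by rewrite Ds Dk; apply: fold_int_heffter; rewrite -?Dk.
Qed.
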